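(* Let $u$ be a field ordinal. Then the algebraic closure of $u$ in $\mathrm{On}_2$ (the collection of all ordinals that are algebraic over $u$ with respect to the Nim operations) is an ordinal, and it is an algebraic closure of the field $u$.
   Context: $\oplus$ and $\otimes$ denote Nim-sum and Nim-product of ordinals, defined recursively by $\alpha \oplus \beta = \operatorname{mex}\{\alpha' \oplus \beta, \alpha \oplus \beta' \mid \alpha'<\alpha, \beta'<\beta\}$ and $\alpha \otimes \beta = \operatorname{mex}\{(\alpha' \otimes \beta) \oplus (\alpha \otimes \beta') \oplus (\alpha' \otimes \beta') \mid \alpha'<\alpha, \beta'<\beta\}$, where $\operatorname{mex}(S)$ is the least ordinal not in $S$. With these operations the class of ordinals is a Field (a field whose domain is a proper class) of characteristic 2, denoted $\mathrm{On}_2$. An ordinal $u$ is identified with the set of smaller ordinals; a field ordinal is an ordinal $u$ that is a subfield of $\mathrm{On}_2$. All polynomials are with respect to the Nim operations. *)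

(* Defs.v *)
From HB Require Import structures.
From mathcomp Require Import all_boot all_order all_algebra.
From mathcomp Require Import boolp.

Set Implicit Arguments.
Unset Strict Implicit.
Unset Printing Implicit Defensive.

Import Order.TTheory GRing.Theory.

Local Open Scope ring_scope.
Local Open Scope quotient_scope.

(* A term [Sup f] names the least ordinal strictly above all the [f a].  The
   index types range over a fixed universe, whose elements play the role of the
   sets; thus [On] is the class of all ordinals of that universe.  Distinct
   terms may name the same ordinal, so [On] is a quotient.                    *)
Inductive preord : Type := Sup (A : Type) of A -> preord.

Fixpoint preord_le (s t : preord) : Prop :=
  let: Sup A f := s in let: Sup B g := t in
  forall a : A, exists b : B, preord_le (f a) (g b).

Definition preord_lt (s t : preord) : Prop :=
  let: Sup B g := t in exists b : B, preord_le s (g b).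

Lemma preord_leP s t :
  preord_le s t <-> let: Sup A f := s in forall a : A, preord_lt (f a) t.
Proof. by case: s t => A f [B g]; split=> H a; exact: (H a). Qed.

Lemma preord_le_refl t : preord_le t t.
Proof. by elim: t => A f IH a; exists a; exact: IH. Qed.

Lemma preord_le_trans s t r : preord_le s t -> preord_le t r -> preord_le s r.
Proof.
elim: s t r => A f IH [B g] [C h] /= fg gh a.
have [b ab] := fg a; have [c bc] := gh b; exists c; exact: IH ab bc.
Qed.

Lemma preord_total s t : preord_le s t \/ preord_lt t s.
Proof.
elim: s t => A f IH t; have [H|/existsNP[a H]] :=
  pselect (forall a, preord_lt (f a) t); first by left; apply/preord_leP.
right; exists a; case: t H => B g H.
apply/preord_leP => b; have [le|//] := IH a (g b).
by case: H; exists b.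
Qed.

Lemma preord_lt_le_trans s t r :
  preord_lt s t -> preord_le t r -> preord_lt s r.
Proof.
case: t r => B g [C h] /= [b sb] gh; have [c bc] := gh b; exists c.
exact: preord_le_trans bc.
Qed.

Lemma preord_le_lt_trans s t r :
  preord_le s t -> preord_lt t r -> preord_lt s r.
Proof. by case: r => C h st [c tc]; exists c; exact: preord_le_trans tc. Qed.

Lemma preord_lt_irr t : ~ preord_lt t t.
Proof.
elim: t => A f IH [a /preord_leP /(_ a)]; exact: IH.
Qed.

Lemma preord_ltW s t : preord_lt s t -> preord_le s t.
Proof.
have le_Sup : forall r, let: Sup B g := r in forall b, preord_le (g b) r.
  elim=> B g IH b; apply/preord_leP; have := IH b.
  by case E: (g b) => [C h] H c; exists b; rewrite E; exact: H.
case: t => B g [b sb]; exact: preord_le_trans sb (le_Sup (Sup g) b).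
Qed.

HB.instance Definition _ := gen_eqMixin preord.
HB.instance Definition _ := gen_choiceMixin preord.

Definition preord_equiv : rel preord :=
  fun s t => `[< preord_le s t /\ preord_le t s >].

Lemma preord_equiv_refl : reflexive preord_equiv.
Proof. by move=> t; apply/asboolP; split; exact: preord_le_refl. Qed.

Lemma preord_equiv_sym : symmetric preord_equiv.
Proof. by move=> s t; apply/asboolP/asboolP => -[]. Qed.

Lemma preord_equiv_trans : transitive preord_equiv.
Proof.
move=> t s r /asboolP[st ts] /asboolP[tr rt]; apply/asboolP; split.
  exact: preord_le_trans tr.
exact: preord_le_trans ts.
Qed.

Canonical preord_equiv_rel := EquivRel preord_equiv preord_equiv_refl
  preord_equiv_sym preord_equiv_trans.

Definition On := {eq_quot preord_equiv}.

HB.instance Definition _ := Choice.on On.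
HB.instance Definition _ := EqQuotient.on On.

Definition On_le : rel On := fun x y => `[< preord_le (repr x) (repr y) >].

Lemma On_le_anti : antisymmetric On_le.
Proof.
move=> x y /andP[/asboolP xy /asboolP yx]; rewrite -[x]reprK -[y]reprK.
by apply/eqmodP/asboolP.
Qed.

Lemma On_le_trans : transitive On_le.
Proof.
move=> y x z /asboolP xy /asboolP yz; apply/asboolP.
exact: preord_le_trans yz.
Qed.

Lemma On_le_total : total On_le.
Proof.
move=> x y; have [xy|/preord_ltW yx] := preord_total (repr x) (repr y).
  by apply/orP; left; apply/asboolP.
by apply/orP; right; apply/asboolP.
Qed.

Fact On_display : Order.disp_t. Proof. exact: Order.Disp tt tt. Qed.

HB.instance Definition _ := Order.isOrder.Build On_display On
  (fun _ _ => erefl) (fun _ _ => erefl) (fun _ _ => erefl)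
  On_le_anti On_le_trans On_le_total.

Lemma pi_preord_equiv (s : preord) :
  preord_le s (repr (\pi_On s)) /\ preord_le (repr (\pi_On s)) s.
Proof.
have /eqmodP/asboolP[] : \pi_On s = \pi_On (repr (\pi_On s)) by rewrite reprK.
by [].
Qed.

Lemma lt_On_repr (x y : On) : (x < y)%O <-> preord_lt (repr x) (repr y).
Proof.
rewrite ltNge; split=> [|xy].
  move/negP=> nyx; have [yx|//] := preord_total (repr y) (repr x).
  by case: nyx; apply/asboolP.
apply/negP => /asboolP yx.
exact: (@preord_lt_irr (repr x)) (preord_lt_le_trans xy yx).
Qed.

Definition supS (A : Type) (f : A -> On) : On := \pi_On (Sup (repr \o f)).

Lemma lt_supS (A : Type) (f : A -> On) (x : On) :
  (x < supS f)%O <-> exists a, (x <= f a)%O.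
Proof.
have [s1 s2] := pi_preord_equiv (Sup (repr \o f)).
rewrite lt_On_repr; split=> [/preord_lt_le_trans /(_ s2) [a xa]|[a /asboolP xa]].
  by exists a; apply/asboolP.
by apply: preord_lt_le_trans s1; exists a.
Qed.

Lemma On_lt_wf : well_founded (fun x y : On => (x < y)%O).
Proof.
suff H : forall (t : preord) (x : On), preord_le (repr x) t ->
    Acc (fun x y : On => (x < y)%O) x.
  by move=> x; apply: (H (repr x)); exact: preord_le_refl.
elim=> A f IH x xf; constructor => y /lt_On_repr yx.
by have [a ya] := preord_lt_le_trans yx xf; exact: IH ya.
Qed.

Lemma On_ind (P : On -> Prop) :
  (forall x : On, (forall y : On, (y < x)%O -> P y) -> P x) -> forall x : On, P x.
Proof. exact: well_founded_ind On_lt_wf P. Qed.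

Lemma On_min (P : On -> Prop) : (exists x, P x) ->
  exists x, P x /\ forall y, P y -> (x <= y)%O.
Proof.
move=> [x Px]; apply: contrapT => H; suff: ~ P x by [].
elim/On_ind: x {Px} => x IH Px; apply: H; exists x; split=> // y Py.
by rewrite leNgt; apply/negP => /IH.
Qed.

(* [small S]: the class [S] is a set, i.e. is covered by a family indexed in
   the universe of the index types of [preord].                               *)
Definition small (S : On -> Prop) : Prop :=
  exists (A : Type) (f : A -> On), forall x, S x -> exists a, x = f a.

Lemma small_bounded S : small S -> exists y, forall x, S x -> (x < y)%O.
Proof.
move=> [A [f Sf]]; exists (supS f) => x /Sf[a ->].
by apply/lt_supS; exists a.
Qed.

Fixpoint preord_pos (t : preord) : Type :=
  let: Sup A f := t in {a : A & option (preord_pos (f a))}.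

Fixpoint preord_sub (t : preord) : preord_pos t -> preord :=
  match t return preord_pos t -> preord with
  | Sup A f => fun p => let: existT a q := p in
               if q is Some q then preord_sub q else f a
  end.

Lemma preord_subP s t : preord_lt s t ->
  exists p : preord_pos t, preord_equiv s (preord_sub p).
Proof.
elim: t s => A f IH s [a sa].
have [as_|/IH[p sp]] := preord_total (f a) s.
  by exists (existT _ a None); apply/asboolP.
by exists (existT _ a (Some p)).
Qed.

Lemma small_lt (u : On) : small (fun x => (x < u)%O).
Proof.
exists (preord_pos (repr u)), (fun p => \pi_On (preord_sub p)).
move=> x /lt_On_repr /preord_subP[p xp]; exists p.
by rewrite -[x]reprK; apply/eqmodP.
Qed.

Lemma small_sub (S T : On -> Prop) : (forall x, S x -> T x) -> small T -> small S.
Proof. by move=> ST [A [f Tf]]; exists A, f => x /ST /Tf. Qed.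

Lemma small_union (S T : On -> Prop) :
  small S -> small T -> small (fun x => S x \/ T x).
Proof.
move=> [A [f Sf]] [B [g Tg]].
exists (A + B)%type, (fun i => match i with inl a => f a | inr b => g b end).
by move=> x [/Sf[a ->]|/Tg[b ->]]; [exists (inl a)|exists (inr b)].
Qed.

Lemma small_image (h : On -> On) (S : On -> Prop) :
  small S -> small (fun x => exists2 a, S a & x = h a).
Proof.
move=> [A [f Sf]]; exists A, (h \o f) => x [a /Sf[i ->] ->]; by exists i.
Qed.

Lemma small_image2 (h : On -> On -> On) (S T : On -> Prop) :
  small S -> small T ->
  small (fun x => exists a b, [/\ S a, T b & x = h a b]).
Proof.
move=> [A [f Sf]] [B [g Tg]].
exists (A * B)%type, (fun i => h (f i.1) (g i.2)).
by move=> x [a [b [/Sf[i ->] /Tg[j ->] ->]]]; exists (i, j).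
Qed.

Lemma On_inhabited : exists x : On, True.
Proof. by exists (supS (fun e : False => match e with end)). Qed.

Definition is_mex (S : On -> Prop) (x : On) : Prop :=
  ~ S x /\ forall y, ~ S y -> (x <= y)%O.

Lemma mex_ex S : exists x, (exists y, ~ S y) -> is_mex S x.
Proof.
have [/On_min[x]|nS] := pselect (exists y, ~ S y).
  by exists x.
by have [x _] := On_inhabited; exists x => /nS.
Qed.

(* Only meaningful when [S] is not all of [On]; in particular for small [S].  *)
Definition mex (S : On -> Prop) : On := projT1 (cid (mex_ex S)).

Lemma small_mexP S : small S ->
  ~ S (mex S) /\ forall y, (y < mex S)%O -> S y.
Proof.
move=> /small_bounded[u Su]; rewrite /mex; case: cid => x /= [].
  by exists u => /Su; rewrite ltxx.
move=> nSx H; split=> // y yx; apply: contrapT => /H.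
by rewrite leNgt yx.
Qed.

Lemma mex_eq S x : ~ S x -> (forall y, (y < x)%O -> S y) -> mex S = x.
Proof.
move=> nSx H; rewrite /mex; case: cid => z /= []; first by exists x.
move=> nSz zmin; apply/eqP; rewrite eq_le zmin //= leNgt.
by apply/negP => /H.
Qed.

Definition nim_add_opts (add : On -> On -> On) (a b : On) : On -> Prop :=
  fun x => (exists2 a', (a' < a)%O & x = add a' b) \/
           (exists2 b', (b' < b)%O & x = add a b').

Definition nim_mul_opts (add mul : On -> On -> On) (a b : On) : On -> Prop :=
  fun x => exists a' b', [/\ (a' < a)%O, (b' < b)%O &
    x = add (add (mul a' b) (mul a b')) (mul a' b')].

(* Both recursions are on the first argument, with an inner recursion on the
   second; [nim_addE] and [nim_mulE] below are the intended equations.        *)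
Definition nim_add : On -> On -> On :=
  Fix On_lt_wf (fun _ => On -> On) (fun a Fa =>
    Fix On_lt_wf (fun _ => On) (fun b Fb =>
      mex (fun x => (exists a' (lt_a : (a' < a)%O), x = Fa a' lt_a b) \/
                    (exists b' (lt_b : (b' < b)%O), x = Fb b' lt_b)))).

Definition nim_mul : On -> On -> On :=
  Fix On_lt_wf (fun _ => On -> On) (fun a Fa =>
    Fix On_lt_wf (fun _ => On) (fun b Fb =>
      mex (fun x => exists a' b' (lt_a : (a' < a)%O) (lt_b : (b' < b)%O),
             x = nim_add (nim_add (Fa a' lt_a b) (Fb b' lt_b))
                         (Fa a' lt_a b')))).

Lemma On_FixE (T : Type) (F : forall x : On, (forall y, (y < x)%O -> T) -> T) x :
  Fix On_lt_wf (fun _ => T) F x =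
  F x (fun y _ => Fix On_lt_wf (fun _ => T) F y).
Proof.
apply: (Fix_eq On_lt_wf (fun _ => T)) => {}x f g fg; congr F.
by apply: functional_extensionality_dep => y;
   apply: functional_extensionality_dep => yx.
Qed.

Lemma nim_addE a b : nim_add a b = mex (nim_add_opts nim_add a b).
Proof.
have E c d : nim_add c d = Fix On_lt_wf (fun _ => On) (fun b Fb =>
    mex (fun x => (exists a' (lt_a : (a' < c)%O), x = nim_add a' b) \/
                  (exists b' (lt_b : (b' < b)%O), x = Fb b' lt_b))) d.
  by rewrite {1}/nim_add On_FixE.
rewrite E On_FixE; congr mex; apply/funext => x; apply/propext.
split=> [[[a' [lt_a ->]]|[b' [lt_b ->]]]|[[a' lt_a ->]|[b' lt_b ->]]].
- by left; exists a'.
- by right; exists b' => //; rewrite E.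
- by left; exists a', lt_a.
- by right; exists b', lt_b; rewrite E.
Qed.

Lemma nim_mulE a b : nim_mul a b = mex (nim_mul_opts nim_add nim_mul a b).
Proof.
have E c d : nim_mul c d = Fix On_lt_wf (fun _ => On) (fun b Fb =>
      mex (fun x => exists a' b' (lt_a : (a' < c)%O) (lt_b : (b' < b)%O),
             x = nim_add (nim_add (nim_mul a' b) (Fb b' lt_b))
                         (nim_mul a' b'))) d.
  by rewrite {1}/nim_mul On_FixE.
rewrite E On_FixE; congr mex; apply/funext => x; apply/propext.
split=> [[a' [b' [lt_a [lt_b ->]]]]|[a' [b' [lt_a lt_b ->]]]];
  exists a', b'; first by split=> //; rewrite -E.
by exists lt_a, lt_b; rewrite -E.
Qed.

Lemma nim_add_small a b : small (nim_add_opts nim_add a b).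
Proof.
apply: small_union.
  exact: (small_image (nim_add^~ b) (small_lt a)).
exact: (small_image (nim_add a) (small_lt b)).
Qed.

Lemma nim_mul_small a b : small (nim_mul_opts nim_add nim_mul a b).
Proof.
exact: (small_image2 (fun a' b' => nim_add (nim_add (nim_mul a' b)
  (nim_mul a b')) (nim_mul a' b')) (small_lt a) (small_lt b)).
Qed.

Definition On_zero : On := supS (fun e : False => match e with end).
Definition On_one : On := supS (fun _ : unit => On_zero).

Lemma On_lt0 x : (x < On_zero)%O = false.
Proof. by apply/negP => /lt_supS[]. Qed.

Lemma On_lt1 x : (x < On_one)%O -> x = On_zero.
Proof. by move=> /lt_supS[_]; rewrite le_eqVlt On_lt0 orbF => /eqP. Qed.

Lemma On_lt01 : (On_zero < On_one)%O.
Proof. by apply/lt_supS; exists tt. Qed.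

Lemma nim_addC : commutative nim_add.
Proof.
elim/On_ind => a IHa; elim/On_ind => b IHb; rewrite !nim_addE; congr mex.
apply/funext => x; apply/propext.
split=> -[] [c c_lt ->]; [right|left|right|left]; exists c => //.
- by rewrite IHa.
- by rewrite IHb.
- by rewrite IHb.
- by rewrite (IHa c).
Qed.

Lemma nim_add_neq_lt a a' b : (a' < a)%O -> nim_add a' b <> nim_add a b.
Proof.
move=> lt_a E; have [+ _] := small_mexP (nim_add_small a b).
by rewrite -nim_addE; apply; left; exists a'.
Qed.

Lemma nim_addIr b : injective (nim_add^~ b).
Proof.
move=> a a' /= E; case: (ltgtP a a') => // /nim_add_neq_lt H.
  by case: (H b).
by case: (H b).
Qed.

Lemma nim_add_lt x a b : (x < nim_add a b)%O -> nim_add_opts nim_add a b x.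
Proof.
by rewrite nim_addE; have [_ H] := small_mexP (nim_add_small a b) => /H.
Qed.

Lemma nim_add0 : left_id On_zero nim_add.
Proof.
elim/On_ind => b IH; rewrite nim_addE; apply: mex_eq.
  case=> [[a']|[b' lt_b]]; first by rewrite On_lt0.
  by rewrite IH // => E; rewrite E ltxx in lt_b.
by move=> y yb; right; exists y; rewrite ?IH.
Qed.

Lemma nim_addA : associative nim_add.
Proof.
have Il c : injective (nim_add c).
  by move=> x y; rewrite ![nim_add c _]nim_addC => /nim_addIr.
elim/On_ind => a IHa; elim/On_ind => b IHb; elim/On_ind => c IHc.
case: (ltgtP (nim_add a (nim_add b c)) (nim_add (nim_add a b) c)) => // /nim_add_lt.
  case=> [[z /nim_add_lt[[a' lt_a ->]|[b' lt_b ->]]]|[c' lt_c]].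
  - by rewrite -IHa // => /nim_addIr E; rewrite E ltxx in lt_a.
  - by rewrite -IHb // => /Il/nim_addIr E; rewrite E ltxx in lt_b.
  - by rewrite -IHc // => /Il/Il E; rewrite E ltxx in lt_c.
case=> [[a' lt_a]|[z /nim_add_lt[[b' lt_b ->]|[c' lt_c ->]]]].
- by rewrite IHa // => /nim_addIr/nim_addIr E; rewrite E ltxx in lt_a.
- by rewrite IHb // => /nim_addIr/Il E; rewrite E ltxx in lt_b.
- by rewrite IHc // => /Il E; rewrite E ltxx in lt_c.
Qed.

Lemma nim_addN : left_inverse On_zero id nim_add.
Proof.
elim/On_ind => a IH; rewrite nim_addE; apply: mex_eq; last first.
  by move=> y; rewrite On_lt0.
suff H b : (b < a)%O -> On_zero <> nim_add a b.
  by case=> [] [b lt_b]; rewrite 1?[nim_add b _]nim_addC;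
    exact: H.
move=> lt_b; rewrite -(IH b lt_b) => /nim_addIr /= E.
by rewrite E ltxx in lt_b.
Qed.

HB.instance Definition _ := GRing.isZmodule.Build On
  nim_addA nim_addC nim_add0 nim_addN.

Lemma On_addxx (x : On) : x + x = 0.
Proof. exact: nim_addN. Qed.

Lemma On_addK (x y : On) : x + (x + y) = y.
Proof. by rewrite addrA On_addxx add0r. Qed.

Lemma On_add_eq0 (x y : On) : x + y = 0 -> x = y.
Proof. by move=> E; rewrite -[y](On_addK x) E addr0. Qed.

(* Equalities of sums, by cancelling equal terms in pairs (characteristic 2).  *)
Ltac On_cancel_loop :=
  rewrite ?On_addK ?On_addxx ?addr0 ?add0r;
  try reflexivity;
  lazymatch goal with
  | |- ?x + _ = 0 =>
    repeat match goal with
    | |- context [?y + (x + ?z)] =>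
        tryif constr_eq y x then fail else rewrite (addrCA y x z)
    | |- context [?y + x] =>
        tryif constr_eq y x then fail else rewrite (addrC y x)
    end; On_cancel_loop
  end.

Ltac On_cancel := apply: On_add_eq0; rewrite -?addrA; On_cancel_loop.

Lemma nim_mul_lt (x a b : On) : (x < nim_mul a b)%O ->
  exists a' b', [/\ (a' < a)%O, (b' < b)%O &
    x = nim_mul a' b + nim_mul a b' + nim_mul a' b'].
Proof.
by rewrite nim_mulE; have [_ H] := small_mexP (nim_mul_small a b) => /H.
Qed.

Lemma nim_mul_neq_lt (a a' b b' : On) : (a' < a)%O -> (b' < b)%O ->
  nim_mul a b <> nim_mul a' b + nim_mul a b' + nim_mul a' b'.
Proof.
move=> lt_a lt_b E; have [+ _] := small_mexP (nim_mul_small a b).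
by rewrite -nim_mulE; apply; exists a', b'.
Qed.

Lemma nim_mul_neq (a a' b b' : On) : a <> a' -> b <> b' ->
  nim_mul a b + nim_mul a' b + nim_mul a b' + nim_mul a' b' <> 0.
Proof.
wlog lt_a : a a' / (a' < a)%O.
  move=> H; case: (ltgtP a' a) => [/H|lt_a nab nb E|-> //]; first exact.
  apply: (H a' a lt_a _ nb); first by move/esym.
  by rewrite -E; On_cancel.
wlog lt_b : b b' / (b' < b)%O.
  move=> H; case: (ltgtP b' b) => [/H|lt_b na nb E|-> //]; first exact.
  apply: (H b' b lt_b na); first by move/esym.
  by rewrite -E; On_cancel.
move=> _ _ E; apply: (nim_mul_neq_lt lt_a lt_b); apply: On_add_eq0.
by rewrite -E; On_cancel.
Qed.

Lemma nim_mulC : commutative nim_mul.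
Proof.
elim/On_ind => a IHa; elim/On_ind => b IHb; rewrite !nim_mulE; congr mex.
apply/funext => x; apply/propext.
split=> -[a' [b' [lt_a lt_b ->]]]; exists b', a'; split=> //.
  rewrite [nim_add (nim_mul b' a) _]nim_addC.
  by congr (nim_add (nim_add _ _) _); rewrite ?(IHa a') ?(IHb b').
rewrite [nim_add (nim_mul b' b) _]nim_addC.
by congr (nim_add (nim_add _ _) _); rewrite ?(IHa b') ?(IHb a').
Qed.

Lemma nim_mul0 : left_zero (0 : On) nim_mul.
Proof.
move=> b; rewrite nim_mulE; apply: mex_eq => [[a' [b' []]]|y];
by rewrite On_lt0.
Qed.

Lemma nim_mul1 : left_id On_one nim_mul.
Proof.
elim/On_ind => b IH; rewrite nim_mulE; apply: mex_eq.
  move=> [a' [b' [/On_lt1 -> lt_b]]]; rewrite !nim_mul0 !(IH b') //.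
  by rewrite nim_add0 [nim_add b' _]addr0 => E; rewrite E ltxx in lt_b.
move=> y lt_y; exists On_zero, y; split; rewrite ?On_lt01 //.
by rewrite !nim_mul0 IH // nim_add0 [nim_add y _]addr0.
Qed.

Lemma On_add_lt (x a b : On) : (x < a + b)%O ->
  (exists2 a', (a' < a)%O & x = a' + b) \/
  (exists2 b', (b' < b)%O & x = a + b').
Proof. exact: nim_add_lt. Qed.

Lemma nim_mulDr (a b c : On) :
  nim_mul a (b + c) = nim_mul a b + nim_mul a c.
Proof.
elim/On_ind: a b c => a IHa; elim/On_ind => b IHb; elim/On_ind => c IHc.
case: (ltgtP (nim_mul a (b + c)) (nim_mul a b + nim_mul a c)) => //.
  move=> /On_add_lt[] [z /nim_mul_lt [a' [d [lt_a lt_d ->]]] E].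
    case: (@nim_mul_neq a a' (b + c) (d + c)).
    - by move=> e; rewrite e ltxx in lt_a.
    - by move/addIr => e; rewrite e ltxx in lt_d.
    rewrite E !(IHa a') // IHb //; On_cancel.
  case: (@nim_mul_neq a a' (b + c) (b + d)).
  - by move=> e; rewrite e ltxx in lt_a.
  - by move/addrI => e; rewrite e ltxx in lt_d.
  rewrite E !(IHa a') // IHc //; On_cancel.
move=> /nim_mul_lt [a' [z [lt_a /On_add_lt[] [d lt_d ->]]]] E.
  case: (nim_mul_neq_lt lt_a lt_d); apply: (@addIr _ (nim_mul a c)).
  rewrite E !(IHa a') // IHb //; On_cancel.
case: (nim_mul_neq_lt lt_a lt_d); apply: (@addrI _ (nim_mul a b)).
rewrite E !(IHa a') // IHc //; On_cancel.
Qed.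

Lemma nim_mulDl (a b c : On) :
  nim_mul (a + b) c = nim_mul a c + nim_mul b c.
Proof. by rewrite nim_mulC nim_mulDr ![nim_mul c _]nim_mulC. Qed.

Lemma nim_mulA : associative nim_mul.
Proof.
have neq (d c c' : On) : d <> 0 -> c <> c' -> nim_mul d c + nim_mul d c' <> 0.
  move=> d0 cc' E; case: (@nim_mul_neq d 0 c c') => //.
  by rewrite !nim_mul0 !addr0.
have neqlt (x y : On) : (y < x)%O -> x <> y by move=> + E; rewrite E ltxx.
elim/On_ind => a IHa; elim/On_ind => b IHb; elim/On_ind => c IHc.
case: (ltgtP (nim_mul a (nim_mul b c)) (nim_mul (nim_mul a b) c)) => //.
  move=> /nim_mul_lt [z [c' [/nim_mul_lt[a' [b' [lt_a lt_b ->]]] lt_c]]] E.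
  have e0 := @nim_mul_neq b b' c c' (neqlt _ _ lt_b) (neqlt _ _ lt_c).
  case: (neq _ _ _ e0 (neqlt _ _ lt_a)); rewrite !(nim_mulC _ a) !(nim_mulC _ a').
  rewrite !nim_mulDr E !nim_mulDl -!(IHa a') // -!(IHb b') // -(IHc c') //.
  On_cancel.
move=> /nim_mul_lt [a' [z [lt_a /nim_mul_lt[b' [c' [lt_b lt_c ->]]]]]] E.
have d0 := @nim_mul_neq a a' b b' (neqlt _ _ lt_a) (neqlt _ _ lt_b).
case: (neq _ _ _ d0 (neqlt _ _ lt_c)).
rewrite !nim_mulDl E !nim_mulDr !(IHa a') // !(IHb b') // (IHc c') //.
On_cancel.
Qed.

Lemma On_one_neq0 : On_one != 0.
Proof. by apply/eqP => E; have := On_lt01; rewrite E ltxx. Qed.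

HB.instance Definition _ := GRing.Zmodule_isComNzRing.Build On
  nim_mulA nim_mulC nim_mul1 nim_mulDl On_one_neq0.

Lemma On_ge0 (x : On) : ((0 : On) <= x)%O.
Proof. by rewrite leNgt On_lt0. Qed.

Lemma On_gt0 (x : On) : x != 0 -> ((0 : On) < x)%O.
Proof. by rewrite lt_neqAle On_ge0 eq_sym => ->. Qed.

Lemma On_integral (x y : On) : x * y = 0 -> x = 0 \/ y = 0.
Proof.
move=> E; have [->|/eqP x0] := eqVneq x 0; first by left.
have [->|/eqP y0] := eqVneq y 0; first by right.
have : x * y + 0 * y + x * 0 + 0 * 0 <> 0 := nim_mul_neq x0 y0.
by rewrite E !mulr0 mul0r !addr0.
Qed.

(* Conway's inverse: for [x <> 0] it is the least ordinal outside the closure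
   of [0] under [y' |-> (1 + (x' + x) y') / x'], [0 < x' < x].                *)
Lemma On_inv_ex (x : On) : x != 0 -> exists y : On, y * x = 1.
Proof.
elim/On_ind: x => x IH x0.
have [inv invP] : exists inv : On -> On,
    forall x' : On, x' != 0 -> (x' < x)%O -> inv x' * x' = 1.
  have H (z : On) : exists y : On, z != 0 -> (z < x)%O -> y * z = 1.
    have [z0|] := boolP ((z != 0) && (z < x)%O); last first.
      by move=> /negP nz; exists 0 => z0 zx; case: nz; rewrite z0.
    by have /andP[z1 zx] := z0; have [y yz] := IH z zx z1; exists y.
  by exists (fun z => projT1 (cid (H z))) => z z0 zx; case: cid => /= y; exact.
have [A [f Af]] := small_lt x.
pose g (l : seq A) := foldr (fun a y => inv (f a) * (1 + (f a + x) * y)) 0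
  [seq a <- l | (f a != 0) && (f a < x)%O].
pose S := fun y => exists l, y = g l.
have smallS : small S by exists (seq A), g.
have S0 : S 0 by exists [::].
have Sstep (x' y' : On) : x' != 0 -> (x' < x)%O -> S y' ->
    S (inv x' * (1 + (x' + x) * y')).
  move=> x'0 x'x [l ->]; have [a E] := Af _ x'x; exists (a :: l).
  by rewrite /g /= -E x'0 x'x /= -E.
have Sneq y : S y -> x * y != 1.
  move=> [l ->] {y}; rewrite /g; elim: l => [|a l IHl] /=.
    by rewrite mulr0 eq_sym oner_neq0.
  case: ifP => //= /andP[a0 ax]; move: IHl; set y := foldr _ _ _.
  apply: contraNneq; set x' := f a => E.
  have ax' : x' + x != 0.
    by apply: contraTneq ax => /On_add_eq0; rewrite -/x' => ->; rewrite ltxx.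
  have x'K : x' * inv x' = 1 by rewrite mulrC invP.
  have E2 : (x' + x) * (1 + x * y) = 0.
    rewrite mulrDr mulr1 mulrCA -addrA -[X in X + _ * _]mulr1 -mulrDr.
    have -> : x * (1 + (x' + x) * y) = x'.
      by rewrite -[RHS]mulr1 -[in RHS]E [RHS]mulrCA [x' * (inv x' * _)]mulrA x'K mul1r.
    exact: On_addxx.
  have [/eqP|/On_add_eq0 <- //] := On_integral E2; first by rewrite (negPf ax').
have [nSy ltS] := small_mexP smallS; set y := mex S in nSy ltS.
exists y; rewrite mulrC [LHS]nim_mulE; apply: mex_eq => [|z /On_lt1 ->].
  move=> [x' [y' [lt_x' /ltS Sy' E0]]].
  have {E0} E : 1 = x' * y + x * y' + x' * y' :> On := E0.
  have [x'0|x'0] := eqVneq x' 0.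
    move: E; rewrite x'0 !mul0r add0r addr0 => E.
    by have := Sneq _ Sy'; rewrite -E eqxx.
  case: nSy; suff -> : y = inv x' * (1 + (x' + x) * y') by exact: Sstep.
  rewrite E; have -> : x' * y + x * y' + x' * y' + (x' + x) * y' = x' * y.
    by rewrite mulrDl; On_cancel.
  by rewrite mulrA invP // mul1r.
exists 0, 0; split; first exact: On_gt0.
  by rewrite On_gt0 //; apply/eqP => y0; apply: nSy; rewrite y0.
suff : 0 = 0 * y + x * 0 + 0 * 0 :> On by [].
by rewrite !mul0r mulr0 !addr0.
Qed.

Lemma On_inv_total (x : On) :
  exists y : On, if x == 0 then y = 0 else y * x = 1.
Proof. by case: eqVneq => [_|/On_inv_ex //]; exists 0. Qed.

Definition On_inv (x : On) : On := projT1 (cid (On_inv_total x)).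

Lemma On_mulVf (x : On) : x != 0 -> On_inv x * x = 1.
Proof. by rewrite /On_inv; case: cid => y /=; case: eqVneq. Qed.

Lemma On_inv0 : On_inv 0 = 0.
Proof. by rewrite /On_inv; case: cid => y /=; rewrite eqxx. Qed.

HB.instance Definition _ := GRing.ComNzRing_isField.Build On On_mulVf On_inv0.

Lemma On_addE (a b : On) : a + b = mex (nim_add_opts +%R a b).
Proof. exact: nim_addE. Qed.

Lemma On_mulE (a b : On) : a * b = mex (nim_mul_opts +%R *%R a b).
Proof. exact: nim_mulE. Qed.

(* The ordinal [u], as the set of smaller ordinals.                           *)
Definition below (u : On) : {pred On} := [pred x | (x < u)%O].

Definition is_ordinal (A : {pred On}) : Prop := exists v : On, A =i below v.

Definition field_ordinal (u : On) : Prop := divring_closed (below u).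

(* MathComp's [algebraicOver] is relative to a map between two field types;
   here the base field is a subset [K] of [F].                                *)
Definition algebraic_over (F : fieldType) (K : {pred F}) (a : F) : Prop :=
  exists p : {poly F}, [/\ p \is a polyOver K, p != 0 & root p a].

Definition algebraic_closure_in (F : fieldType) (K : {pred F}) : {pred F} :=
  [pred a | `[< algebraic_over K a >]].

Definition algebraically_closed (F : fieldType) (K : {pred F}) : Prop :=
  forall p : {poly F}, p \is a polyOver K -> (1 < size p)%N ->
  exists2 a, a \in K & root p a.

Definition is_algebraic_closure (F : fieldType) (K L : {pred F}) : Prop :=
  [/\ divring_closed L, {subset K <= L},
      forall a, a \in L -> algebraic_over K a & algebraically_closed L].

(* Main.v *)
(* Let [v] be the least ordinal missing from the algebraic closure [K] of [u];
   it exists because each polynomial has finitely many roots, so [K] is a set.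
   Since [K] is a field, the mex recursions force [v] to be a field: were [v]
   not closed under an operation, [v] itself would be obtained from elements of
   [K].  As [v] is not algebraic over [u], it is transcendental over [v], and
   then every polynomial over [v] splits over [v].  Hence [K] adds nothing to
   [v].                                                                       *)
Require Import Defs.
From HB Require Import structures.
From mathcomp Require Import all_boot all_order all_algebra.
From mathcomp Require Import boolp.

Set Implicit Arguments.
Unset Strict Implicit.
Unset Printing Implicit Defensive.

Import Order.TTheory GRing.Theory.

Local Open Scope ring_scope.

(** * Elements algebraic over a subfield given as a predicate *)

Section Subfield.
Variables (F : fieldType) (K : {pred F}) (hK : divring_closed K).

(** Carrying the closure proof in the term gives instance inference a key for the field structure on
    [K]. *)
Definition subfield_pred of divring_closed K : {pred F} := K.

HB.instance Definition _ :=
  GRing.isDivringClosed.Build F (subfield_pred hK) hK.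

Definition subfield := {x : F | x \in subfield_pred hK}.

HB.instance Definition _ := SubChoice.on subfield.
HB.instance Definition _ := [SubChoice_isSubIntegralDomain of subfield by <:].
HB.instance Definition _ := [SubIntegralDomain_isSubField of subfield by <:].

Definition subfield_val : {rmorphism subfield -> F} := val.

(** Bridge to the theory of integral elements, which supplies closure under the field operations and
    transitivity. *)
Lemma algebraic_overE a : algebraic_over K a <-> integralOver subfield_val a.
Proof.
rewrite -integral_algebraic; split=> [[p [Kp p0 pa]]|[p p0 pa]]; last first.
  exists (map_poly subfield_val p); split; rewrite ?map_poly_eq0 //.
  change (map_poly subfield_val p \is a polyOver (subfield_pred hK)).
  by apply/polyOverP => i; rewrite coef_map; exact: (valP p`_i).
(* The default 0 is harmless: all coefficients of [p] lie in [K], so [subfield_val] maps [q] back to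
   [p]. *)
pose q : {poly subfield} := map_poly (insubd 0) p.
suff E : map_poly subfield_val q = p.
  by exists q; [rewrite -(map_poly_eq0 subfield_val) E|rewrite E].
apply/polyP => i; rewrite coef_map /q coef_map_id0; last first.
  by apply/val_inj; rewrite val_insubd rpred0.
by rewrite [LHS]insubdK //; exact: (@polyOverP _ (subfield_pred hK) _ Kp).
Qed.

Lemma algebraic_over_mem a : a \in K -> algebraic_over K a.
Proof.
move=> Ka; apply/algebraic_overE.
have -> : a = subfield_val (Sub a (Ka : a \in subfield_pred hK)) by [].
exact: integral_id.
Qed.

Lemma algebraic_closure_divring : divring_closed (algebraic_closure_in K).
Proof.
split=> [|x y /asboolP/algebraic_overE Kx /asboolP/algebraic_overE Ky
         |x y /asboolP/algebraic_overE Kx /asboolP/algebraic_overE Ky];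
  apply/asboolP/algebraic_overE; [exact: integral1|exact: integral_sub|].
exact: integral_div.
Qed.

Lemma algebraic_over_trans (L : {pred F}) a :
  (forall x, x \in L -> algebraic_over K x) ->
  algebraic_over L a -> algebraic_over K a.
Proof.
move=> KL [p [Lp p0 pa]]; apply/algebraic_overE.
apply: (integral_root p0 pa) => x px; apply/algebraic_overE/KL.
by move/allP: Lp; apply.
Qed.

End Subfield.

(** * Smallness of the algebraic closure *)

Lemma roots_seq (F : fieldType) (p : {poly F}) : p != 0 ->
  exists rs : seq F, forall x, root p x -> x \in rs.
Proof.
elim: {p}(size p) {-2}p (leqnn (size p)) => [|n IH] p sp p0.
  by move: sp p0; rewrite leqn0 size_poly_eq0 => ->.
have [[x /factor_theorem[q E]]|H] := pselect (exists x, root p x); last first.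
  by exists [::] => x px; case: H; exists x.
have q0 : q != 0 by apply: contraNneq p0 => q0; rewrite E q0 mul0r.
have [|rs Hrs] := IH q _ q0.
  by move: sp; rewrite E size_Mmonic ?monicXsubC // size_XsubC addn2.
exists (x :: rs) => y; rewrite E rootM root_XsubC inE => /orP[/Hrs ->|->] //.
by rewrite orbT.
Qed.

Lemma small_algebraic_closure (K : {pred On}) : small (fun x => x \in K) ->
  small (fun x => x \in algebraic_closure_in K).
Proof.
move=> [A [f Kf]].
have H (p : {poly On}) :
    exists rs : seq On, p != 0 -> forall x, root p x -> x \in rs.
  have [->|/roots_seq[rs]] := eqVneq p 0; first by exists [::].
  by exists rs.
have [rs rsP] := choice H.
(* An algebraic element is coded by the indices of the coefficients of a polynomial and a position
   in its list of roots. *)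
exists (seq A * nat)%type, (fun i => nth 0 (rs (Poly (map f i.1))) i.2).
move=> x /asboolP[p [Kp p0 px]].
suff [l E] : exists l, map f l = p.
  have := rsP _ p0 _ px => /(nthP 0)[i _ <-]; exists (l, i).
  by rewrite /= E polyseqK.
elim: (p : seq On) (allP Kp) => [|y s IH] Ks; first by exists [::].
have [|l <-] := IH; first by move=> z zs; apply: Ks; rewrite inE zs orbT.
have [|a ->] := Kf y; first by apply: Ks; rewrite inE eqxx.
by exists (a :: l).
Qed.

(** * Options of polynomial values, and splitting *)

Lemma On_oppr (x : On) : - x = x.
Proof. by []. Qed.

(** In characteristic 2 an option of a product differs from it by a product of differences, a form
    that iterates to powers. *)
Lemma On_mul_lt (x a b : On) : (x < a * b)%O ->
  exists a' b', [/\ (a' < a)%O, (b' < b)%O & x = a * b + (a + a') * (b + b')].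
Proof.
move=> /nim_mul_lt[a' [b' [lt_a lt_b E]]]; exists a', b'; split=> //.
have -> : x = a' * b + a * b' + a' * b' by [].
rewrite mulrDl !mulrDr; On_cancel.
Qed.

Lemma On_exp_lt (x y : On) n : (y < x ^+ n)%O ->
  exists rs : seq On, [/\ size rs = n, {subset rs <= below x} &
    y = x ^+ n + \prod_(r <- rs) (x - r)].
Proof.
elim: n y => [|n IH] y.
  move=> /On_lt1 ->; exists [::]; split=> //.
  by rewrite big_nil [RHS]On_addxx.
rewrite exprS => /On_mul_lt[r [z [rx /IH[rs [srs xrs ->]] ->]]].
exists (r :: rs); split=> /=; first by rewrite srs.
  by move=> s; rewrite inE => /predU1P[->|/xrs].
by rewrite big_cons On_oppr On_addK.
Qed.

Lemma On_monomial_lt (c x y : On) n : (y < c * x ^+ n)%O ->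
  exists c' (rs : seq On), [/\ (c' < c)%O, size rs = n,
    {subset rs <= below x} &
    y = c * x ^+ n + (c + c') * \prod_(r <- rs) (x - r)].
Proof.
move=> /On_mul_lt[c' [z [cc' /On_exp_lt[rs [srs xrs ->]] ->]]].
by exists c', rs; split=> //; rewrite On_addK.
Qed.

Lemma On_sum_lt (c : nat -> On) (x y : On) n :
  (y < \sum_(i < n) c i * x ^+ i)%O ->
  exists (k : 'I_n) c' (rs : seq On), [/\ (c' < c k)%O, size rs = k,
    {subset rs <= below x} &
    y = \sum_(i < n) c i * x ^+ i + (c k + c') * \prod_(r <- rs) (x - r)].
Proof.
elim: n y => [|n IH] y; first by rewrite big_ord0 On_lt0.
rewrite big_ord_recr /= => /On_add_lt[] [z].
  move=> /IH[k [c' [rs [cc' srs xrs ->]]]] ->.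
  by exists (widen_ord (leqnSn n) k), c', rs; split=> //; rewrite addrAC.
move=> /On_monomial_lt[c' [rs [cc' srs xrs ->]]] ->.
by exists ord_max, c', rs; split=> //; rewrite addrA.
Qed.

(* If [p.[v]] is nonzero then [0] is one of the options defining it, that is
   [p.[v] = g.[v]] with [g] over [v] either monic, split and of the degree of
   [p], or of smaller degree; as [v] is transcendental, [p = g].              *)
Lemma transcendental_split (v : On) (p : {poly On}) :
  divring_closed (below v) -> ~ algebraic_over (below v) v ->
  p \is a polyOver (below v) -> p \is monic ->
  exists2 rs : seq On, {subset rs <= below v} & p = \prod_(r <- rs) ('X - r%:P).
Proof.
move=> hv tr; pose V := subfield_pred hv.
rewrite -[below v]/V => Vp mp.
have neq0 (q : {poly On}) : q \is a polyOver V -> q != 0 -> q.[v] != 0.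
  by move=> Vq q0; apply: contra_notN tr => qv; exists q.
have splitV (rs : seq On) : {subset rs <= V} ->
    \prod_(r <- rs) ('X - r%:P) \is a polyOver V.
  move=> Vrs; rewrite big_seq rpred_prod // => r /Vrs Vr.
  by rewrite rpredB ?polyOverX ?polyOverC.
have hornerV (rs : seq On) :
    (\prod_(r <- rs) ('X - r%:P)).[v] = \prod_(r <- rs) (v - r).
  by rewrite horner_prod; apply: eq_bigr => r _; rewrite !hornerE.
have [n sp] : exists n, size p = n.+1.
  by exists (size p).-1; rewrite polySpred ?monic_neq0.
have lp : p`_n = 1 by move/monicP: mp; rewrite /lead_coef sp.
have := neq0 _ Vp (monic_neq0 mp).
have E : p.[v] = \sum_(i < n) p`_i * v ^+ i + v ^+ n.
  by rewrite horner_coef sp big_ord_recr /= lp mul1r.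
rewrite E => /On_gt0 /On_add_lt[] [z].
  move=> /On_sum_lt[k [c [rs [cp srs Vrs ->]]]].
  rewrite addrAC -E -hornerV => E0.
  have Vc : c \in V by apply: lt_trans cp _; exact: (polyOverP Vp).
  have Vpk : p`_k \in V by exact: (polyOverP Vp).
  (* An option taken in the lower terms would make [v] a root of [q], which is nonzero: as [k < n],
     its coefficient of degree [n] is still 1. *)
  pose q := p + (p`_k + c) *: \prod_(r <- rs) ('X - r%:P).
  have Vq : q \is a polyOver V.
    by rewrite rpredD // polyOverZ ?rpredD ?splitV.
  have q0 : q != 0.
    apply/eqP => q0.
    have := coefD p ((p`_k + c) *: \prod_(r <- rs) ('X - r%:P)) n.
    rewrite -/q q0 coef0 lp coefZ [X in _ * X]nth_default; last first.
      by rewrite size_prod_XsubC srs.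
    by rewrite mulr0 addr0 => /esym/eqP; rewrite oner_eq0.
  by have := neq0 _ Vq q0; rewrite hornerD hornerZ -E0 eqxx.
move=> /On_exp_lt[rs [srs Vrs ->]]; rewrite addrA -E -hornerV => E0.
exists rs => //; apply: subr0_eq; apply: contrapT => /eqP q0.
have Vq : p - \prod_(r <- rs) ('X - r%:P) \is a polyOver V.
  by rewrite rpredB ?splitV.
by have := neq0 _ Vq q0; rewrite hornerD hornerN On_oppr -E0 eqxx.
Qed.

(** * The first ordinal missing from a field is a field *)

Lemma first_missing_divring (K : {pred On}) (v : On) :
  divring_closed K -> v \notin K -> {subset below v <= K} ->
  divring_closed (below v).
Proof.
move=> hK Kv vK; pose L := subfield_pred hK.
have ltv x : x \in L -> ~ (v < x)%O -> (x < v)%O.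
  move=> Lx /negP; rewrite -leNgt le_eqVlt => /predU1P[E|//].
  by move: Kv; rewrite -E [_ \in K]Lx.
(* For sums and products alike, the result lies in [K], so it is not [v]; were it above [v], then
   [v] would be one of its options, hence below itself by induction. *)
have addv a b : (a < v)%O -> (b < v)%O -> (a + b < v)%O.
  elim/On_ind: a b => a IHa; elim/On_ind => b IHb av bv; apply: ltv.
    by apply: rpredD; exact: vK.
  move=> /On_add_lt[[a' lt_a E]|[b' lt_b E]]; suff: (v < v)%O by rewrite ltxx.
    by rewrite {1}E; apply: IHa => //; exact: lt_trans av.
  by rewrite {1}E; apply: IHb => //; exact: lt_trans bv.
have mulv a b : (a < v)%O -> (b < v)%O -> (a * b < v)%O.
  elim/On_ind: a b => a IHa; elim/On_ind => b IHb av bv; apply: ltv.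
    by apply: rpredM; exact: vK.
  move=> /nim_mul_lt[a' [b' [lt_a lt_b E]]].
  have a'v := lt_trans lt_a av; have b'v := lt_trans lt_b bv.
  suff: (v < v)%O by rewrite ltxx.
  rewrite {1}E.
  by apply: (addv (a' * b + a * b')); [apply: addv|];
    [exact: IHa|exact: IHb|exact: IHa].
have L1 : ((1 : On) < v)%O.
  apply: ltv; first exact: rpred1.
  move=> /On_lt1 E; move: Kv; have -> : v = 0 by [].
  by rewrite -[K]/L rpred0.
have v0 : ((0 : On) < v)%O := lt_trans On_lt01 L1.
have invv a : (a < v)%O -> (a^-1 < v)%O.
  elim/On_ind: a => a IH av.
  have [->|a0] := eqVneq a 0; first by rewrite invr0.
  apply: contraT => /negP nav.
  (* Otherwise [v] is the inverse of [a]: the option [0] of [v * a] occurs, and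
     an option equal to [1] would express [v] by smaller ordinals.            *)
  suff E : v * a = 1.
    by move: Kv; rewrite -[v](mulfK a0) E mul1r -[K]/L rpredV [_ \in L]vK.
  rewrite On_mulE; apply: mex_eq => [|y /On_lt1 ->]; last first.
    have H : 0 = 0 * a + v * 0 + 0 * 0 :> On by rewrite !mul0r mulr0 !addr0.
    by exists 0, 0; split; [exact: v0|exact: On_gt0|exact: H].
  move=> [w [b [wv ba E0]]]; have bv := lt_trans ba av.
  have {E0} E : 1 = w * a + v * b + w * b := E0.
  (* For [b = 0] the equation gives [a^-1 = w], below [v]; otherwise it is solved for [v], and
     [b < a] puts [b^-1] below [v] by induction. *)
  have [b0|b0] := eqVneq b 0.
    move: E; rewrite b0 !mulr0 !addr0 => E; apply: nav.
    by rewrite -[a^-1]mul1r E mulfK.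
  suff: (v < v)%O by rewrite ltxx.
  suff {1}-> : v = (1 + w * a + w * b) * b^-1.
    have wabv := addv _ _ (addv _ _ L1 (mulv _ _ wv av)) (mulv _ _ wv bv).
    exact: mulv wabv (IH b ba bv).
  suff -> : 1 + w * a + w * b = v * b by rewrite mulfK.
  rewrite E; On_cancel.
split=> [|a b av bv|a b av bv]; [exact: L1|exact: addv|].
by apply: mulv => //; exact: invv.
Qed.

(** * Identifying the closure with its first missing ordinal *)

Theorem proposition3p1 (u : On) (hu : field_ordinal u) :
  is_ordinal (algebraic_closure_in (below u)) /\
  is_algebraic_closure (below u) (algebraic_closure_in (below u)).
Proof.
set K := algebraic_closure_in (below u).
have hK : divring_closed K := algebraic_closure_divring hu.
have [v [Kv minv]] : exists v, v \notin K /\ forall y, y \notin K -> (v <= y)%O.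
  apply: (@On_min (fun v => v \notin K)).
  have [y yK] := small_bounded (small_algebraic_closure (small_lt u)).
  by exists y; apply/negP => /yK; rewrite ltxx.
have vK : {subset below v <= K}.
  by move=> x; apply: contraLR => /minv; rewrite [_ \in _]ltNge => ->.
have uv : {subset below u <= below v}.
  move=> x xu; apply: contraT; rewrite [_ \in _]ltNge negbK => vx.
  case/negP: Kv; apply/asboolP/(algebraic_over_mem hu).
  exact: le_lt_trans vx xu.
have hv := first_missing_divring hK Kv vK.
have tr : ~ algebraic_over (below v) v.
  move=> /(algebraic_over_trans hu) H; case/negP: Kv; apply/asboolP/H.
  by move=> x /vK /asboolP.
have split_v (p : {poly On}) : p \is a polyOver (below v) -> p != 0 ->
    exists2 rs : seq On, {subset rs <= below v} &
      p = lead_coef p *: \prod_(r <- rs) ('X - r%:P).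
  move=> Vp p0; have lp0 : lead_coef p != 0 by rewrite lead_coef_eq0.
  (* The leading coefficient is invertible in the field [v], which reduces to the monic case. *)
  have [||rs Vrs E] := @transcendental_split v ((lead_coef p)^-1 *: p) hv tr.
  - rewrite -[below v]/(subfield_pred hv) polyOverZ // rpredV.
    exact: (@polyOverP _ (subfield_pred hv) _ Vp).
  - by rewrite monicE lead_coefZ mulVf.
  by exists rs; rewrite // -E scalerA divff // scale1r.
have KE : K =i below v.
  move=> a; apply/idP/idP => [/asboolP[p [up p0 pa]]|/vK //].
  have [|rs Vrs E] := split_v p _ p0; first exact: polyOverS uv _ up.
  by move: pa; rewrite E rootZ ?lead_coef_eq0 // root_prod_XsubC => /Vrs.
split; first by exists v.
split=> // [x /(algebraic_over_mem hu) ?|a /asboolP //|p Kp sp].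
  exact/asboolP.
have p0 : p != 0 by rewrite -size_poly_gt0 ltnW.
have [|rs Vrs E] := split_v p _ p0.
  by apply: polyOverS Kp => x; rewrite KE.
move: sp; rewrite E size_scale ?lead_coef_eq0 // size_prod_XsubC.
case: rs Vrs E => // r rs Vrs E _.
have r_rs : r \in r :: rs by rewrite inE eqxx.
exists r; first by rewrite KE; exact: Vrs.
by rewrite rootZ ?lead_coef_eq0 // root_prod_XsubC.
Qed.
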